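(* Let $(\mathcal{A},\mathcal{B},\mathcal{C})$ be an $\mathfrak{s}$-recollement of extriangulated categories. Let $\mathrm{Iso}\,\mathcal{C}$ be the class of all isomorphisms in $\mathcal{C}$, let $\mathcal{I}=(j^{*})^{-1}(\mathrm{Iso}\,\mathcal{C})$ be the class of morphisms $f$ of $\mathcal{B}$ such that $j^*(f)$ is an isomorphism, and let $\widetilde{\mathcal{B}}$, equipped with an exact functor $Q:\mathcal{B}\to\widetilde{\mathcal{B}}$, be the localization of $\mathcal{B}$ by $\mathcal{I}$. Then there is a unique equivalence functor $\widetilde{j^*}:\widetilde{\mathcal{B}}\to\mathcal{C}$ such that $j^*=\widetilde{j^*}Q$.
   Context: Extriangulated categories (Nakaoka--Palu). An extriangulated category is a triple $(\mathcal{C},\mathbb{E},\mathfrak{s})$ where $\mathcal{C}$ is an additive category, $\mathbb{E}:\mathcal{C}^{\mathrm{op}}\times\mathcal{C}\to\mathrm{Ab}$ is an additive bifunctor (write $a_*\delta=\mathbb{E}(C,a)(\delta)$ and $c^*\delta=\mathbb{E}(c,A)(\delta)$), and $\mathfrak{s}$ assigns to each $\delta\in\mathbb{E}(C,A)$ an equivalence class $\mathfrak{s}(\delta)=[A\xrightarrow{x}B\xrightarrow{y}C]$ (two such sequences are equivalent if there is an isomorphism of the middle terms compatible with the identities of $A$ and $C$), such that: (i) if $\mathfrak{s}(\delta)=[A\xrightarrow{x}B\xrightarrow{y}C]$, $\mathfrak{s}(\delta')=[A'\xrightarrow{x'}B'\xrightarrow{y'}C']$ and $a:A\to A'$, $c:C\to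 C'$ satisfy $a_*\delta=c^*\delta'$, there is $b:B\to B'$ with $bx=x'a$, $y'b=cy$; (ii) $\mathfrak{s}(0)$ is the split sequence and $\mathfrak{s}(\delta\oplus\delta')=\mathfrak{s}(\delta)\oplus\mathfrak{s}(\delta')$; (ET3) for $\delta,\delta'$ realized as in (i) and $a,b$ with $bx=x'a$ there is $c$ with $cy=y'b$ and $a_*\delta=c^*\delta'$; (ET3)$^{\mathrm{op}}$ its dual; (ET4) if $\delta\in\mathbb{E}(D,A)$, $\delta'\in\mathbb{E}(F,B)$ are realized by $A\xrightarrow{f}B\xrightarrow{f'}D$ and $B\xrightarrow{g}C\xrightarrow{g'}F$, there are $E$, $\delta''\in\mathbb{E}(E,A)$ realized by $A\xrightarrow{gf}C\xrightarrow{h'}E$, and $d:D\to E$, $e:E\to F$ with $h'g=df'$, $eh'=g'$, $D\xrightarrow{d}E\xrightarrow{e}F$ realizing $f'_*\delta'$, $d^*\delta''=\delta$, $f_*\delta''=e^*\delta'$; (ET4)$^{\mathrm{op}}$ its dual. If $\mathfrak{s}(\delta)=[A\xrightarrow{x}B\xrightarrow{y}C]$, the sequence is a conflation, $x$ is an inflation, $y$ is a deflation, $C=\mathrm{Cone}(x)$, $A=\mathrm{CoCone}(y)$, and $A\to B\to C\overset{\delta}{\dashrightarrow}$ is an $\mathbb{E}$-triangle. Exact functor. An additive functor $F:\mathcal{A}\to\mathcal{B}$ between extriangulated categories is exact if there is a natural transformation $\eta:\mathbb{E}_{\mathcal{A}}(-,-)\Rightarrow\mathbb{E}_{\mathcal{B}}(F(-),F(-))$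 with $\mathfrak{s}_{\mathcal{B}}(\eta_{(C,A)}(\delta))=[FA\xrightarrow{Fx}FB\xrightarrow{Fy}FC]$ whenever $\mathfrak{s}_{\mathcal{A}}(\delta)=[A\xrightarrow{x}B\xrightarrow{y}C]$. A sequence $A\xrightarrow{f}B\xrightarrow{g}C$ is right $\mathfrak{s}$-exact if there are an $\mathbb{E}$-triangle $K\xrightarrow{h_2}B\xrightarrow{g}C\dashrightarrow$ and a deflation $h_1:A\to K$ with $f=h_2h_1$; it is left $\mathfrak{s}$-exact if there are an $\mathbb{E}$-triangle $A\xrightarrow{f}B\xrightarrow{h_1}K\dashrightarrow$ and an inflation $h_2:K\to C$ with $g=h_2h_1$. $\mathfrak{s}$-recollement $(\mathcal{A},\mathcal{B},\mathcal{C})$: additive functors $i_*:\mathcal{A}\to\mathcal{B}$, $i^*,i^!:\mathcal{B}\to\mathcal{A}$, $j^*:\mathcal{B}\to\mathcal{C}$, $j_!,j_*:\mathcal{C}\to\mathcal{B}$ such that: (SR1) $(i^*,i_*,i^!)$ and $(j_!,j^*,j_* )$ are adjoint triples, and $i_*$ and $j^*$ are exact; (SR2) $j^*i_*=0$; (SR3) $i_*,j_!,j_*$ are fully faithful; (SR4) for each $X\in\mathcal{B}$ there are a left $\mathfrak{s}$-exact sequence $i_*i^!X\xrightarrow{\theta_X}X\xrightarrow{\vartheta_X}j_*j^*X$ and a right $\mathfrak{s}$-exact sequence $j_!j^*X\xrightarrow{\upsilon_X}X\xrightarrow{\nu_X}i_*i^*X$, with $\mathrm{Cone}(\theta_X)\in\mathrm{Ker}\,i^!$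 and $\mathrm{CoCone}(\nu_X)\in\mathrm{Ker}\,i^*$, all maps being the adjunction (unit/counit) morphisms; (SR5) $\mathrm{Ker}\,i^!\cap\mathrm{Ker}\,j^*=0$ or $\mathrm{Ker}\,i^*\cap\mathrm{Ker}\,j^*=0$. Here $\mathrm{Ker}\,F$ is the full subcategory of objects annihilated by $F$. Localization (Nakaoka--Ogawa--Sakai). For a class $\mathcal{I}$ of morphisms of an extriangulated category $\mathcal{B}$ closed under composition and containing identities, $N_{\mathcal{I}}$ is the full subcategory of objects $N$ such that $N\to0$ and $0\to N$ belong to $\mathcal{I}$; $\overline{\mathcal{B}}=\mathcal{B}/[N_{\mathcal{I}}]$ is the ideal quotient (same objects, morphisms modulo those factoring through an object of $N_{\mathcal{I}}$), $p:\mathcal{B}\to\overline{\mathcal{B}}$ the quotient functor, and $\overline{\mathcal{I}}$ the closure of $p(\mathcal{I})$ under composition with isomorphisms of $\overline{\mathcal{B}}$. The localization $\widetilde{\mathcal{B}}$ of $\mathcal{B}$ by $\mathcal{I}$ is the localization of $\overline{\mathcal{B}}$ at $\overline{\mathcal{I}}$, with $Q$ the composite $\mathcal{B}\xrightarrow{p}\overline{\mathcal{B}}\to\widetilde{\mathcal{B}}$; under suitable conditions on $\mathcal{I}$ established by Nakaoka--Ogawa--Sakai it carries an extriangulated structure for which $Q$ is exact and universal among exact functors inverting $\mathcal{I}$. *)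

(* Defs.v *)
From HB Require Import structures.
From mathcomp Require Import all_boot generic_quotient ssralg.
From mathcomp Require Import boolp.

Set Implicit Arguments.
Unset Strict Implicit.
Unset Printing Implicit Defensive.

Import GRing.Theory.
Local Open Scope ring_scope.
Local Open Scope quotient_scope.

Record category := Category {
  ob :> Type;
  hom : ob -> ob -> Type;
  idm : forall X, hom X X;
  comp : forall X Y Z, hom Y Z -> hom X Y -> hom X Z;
  comp1m : forall X Y (f : hom X Y), comp (idm Y) f = f;
  compm1 : forall X Y (f : hom X Y), comp f (idm X) = f;
  compA : forall X Y Z W (h : hom Z W) (g : hom Y Z) (f : hom X Y),
    comp h (comp g f) = comp (comp h g) f }.

Arguments hom {_} _ _.
Arguments idm {_} _.
Arguments comp {_ _ _ _} _ _.

Notation "g \oc f" := (comp g f) (at level 40, left associativity).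

Definition is_iso (C : category) (X Y : C) (f : hom X Y) : Prop :=
  exists g : hom Y X, g \oc f = idm X /\ f \oc g = idm Y.

Record functor (C D : category) := Functor {
  fob :> C -> D;
  fmor : forall X Y : C, hom X Y -> hom (fob X) (fob Y);
  fmor_id : forall X : C, fmor (idm X) = idm (fob X);
  fmor_comp : forall (X Y Z : C) (g : hom Y Z) (f : hom X Y),
    fmor (g \oc f) = fmor g \oc fmor f }.

Arguments fmor {_ _} _ {_ _} _.

Definition id_functor (C : category) : functor C C :=
  @Functor C C (fun X => X) (fun X Y f => f) (fun X => erefl)
    (fun X Y Z g f => erefl).

Section CompFunctor.
Variables (C D E : category) (G : functor D E) (F : functor C D).

Lemma comp_functor_id (X : C) : fmor G (fmor F (idm X)) = idm (G (F X)).
Proof. by rewrite !fmor_id. Qed.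

Lemma comp_functor_comp (X Y Z : C) (g : hom Y Z) (f : hom X Y) :
  fmor G (fmor F (g \oc f)) = fmor G (fmor F g) \oc fmor G (fmor F f).
Proof. by rewrite !fmor_comp. Qed.

Definition comp_functor : functor C E :=
  @Functor C E (fun X => G (F X)) (fun X Y f => fmor G (fmor F f))
    comp_functor_id comp_functor_comp.
End CompFunctor.

Definition fully_faithful (C D : category) (F : functor C D) : Prop :=
  forall X Y : C, bijective (fun f : hom X Y => fmor F f).

Definition naturally_isomorphic (C D : category) (F G : functor C D) : Prop :=
  exists alpha : forall X : C, hom (F X) (G X),
    (forall (X Y : C) (f : hom X Y),
        alpha Y \oc fmor F f = fmor G f \oc alpha X)
    /\ (forall X, is_iso (alpha X)).

Definition is_equivalence (C D : category) (F : functor C D) : Prop :=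
  exists G : functor D C,
    naturally_isomorphic (comp_functor G F) (id_functor C)
    /\ naturally_isomorphic (comp_functor F G) (id_functor D).

(* [adjunction L R] : L is left adjoint to R, by unit and counit. *)
Record adjunction (C D : category) (L : functor C D) (R : functor D C) := {
  adj_unit : forall X : C, hom X (R (L X));
  adj_counit : forall Y : D, hom (L (R Y)) Y;
  adj_unit_nat : forall (X X' : C) (f : hom X X'),
    adj_unit X' \oc f = fmor R (fmor L f) \oc adj_unit X;
  adj_counit_nat : forall (Y Y' : D) (g : hom Y Y'),
    adj_counit Y' \oc fmor L (fmor R g) = g \oc adj_counit Y;
  adj_triangleL : forall X : C,
    adj_counit (L X) \oc fmor L (adj_unit X) = idm (L X);
  adj_triangleR : forall Y : D,
    fmor R (adj_counit Y) \oc adj_unit (R Y) = idm (R Y) }.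

Definition mclass (C : category) := forall X Y : C, hom X Y -> Prop.

Definition iso_class (C : category) : mclass C := fun X Y f => is_iso f.

Definition preim_class (C D : category) (F : functor C D) (W : mclass D) :
  mclass C := fun X Y f => W _ _ (fmor F f).

Definition inverts (C D : category) (W : mclass C) (F : functor C D) : Prop :=
  forall (X Y : C) (f : hom X Y), W X Y f -> is_iso (fmor F f).

(* Localization in the strict sense of Gabriel and Zisman: functors are
   compared by equality, not up to natural isomorphism. *)
Definition is_localization_at (C D : category) (W : mclass C)
    (L : functor C D) : Prop :=
  inverts W L /\
  forall (T : category) (F : functor C T), inverts W F ->
    exists! G : functor D T, comp_functor G L = F.

Record addcat := AddCat {
  ac_ob : Type;
  ac_hom : ac_ob -> ac_ob -> zmodType;
  ac_id : forall X, ac_hom X X;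
  ac_comp : forall X Y Z, ac_hom Y Z -> ac_hom X Y -> ac_hom X Z;
  ac_comp1m : forall X Y (f : ac_hom X Y), ac_comp (ac_id Y) f = f;
  ac_compm1 : forall X Y (f : ac_hom X Y), ac_comp f (ac_id X) = f;
  ac_compA : forall X Y Z W
      (h : ac_hom Z W) (g : ac_hom Y Z) (f : ac_hom X Y),
    ac_comp h (ac_comp g f) = ac_comp (ac_comp h g) f;
  ac_compDl : forall X Y Z (g g' : ac_hom Y Z) (f : ac_hom X Y),
    ac_comp (g + g') f = ac_comp g f + ac_comp g' f;
  ac_compDr : forall X Y Z (g : ac_hom Y Z) (f f' : ac_hom X Y),
    ac_comp g (f + f') = ac_comp g f + ac_comp g f';
  ac_zero : ac_ob;
  (* equivalently, ac_zero is initial and terminal: see [is_zero_obP] *)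
  ac_zeroE : ac_id ac_zero = 0;
  ac_sum : ac_ob -> ac_ob -> ac_ob;
  ac_in1 : forall X Y, ac_hom X (ac_sum X Y);
  ac_in2 : forall X Y, ac_hom Y (ac_sum X Y);
  ac_pr1 : forall X Y, ac_hom (ac_sum X Y) X;
  ac_pr2 : forall X Y, ac_hom (ac_sum X Y) Y;
  ac_pr1in1 : forall X Y, ac_comp (ac_pr1 X Y) (ac_in1 X Y) = ac_id X;
  ac_pr2in2 : forall X Y, ac_comp (ac_pr2 X Y) (ac_in2 X Y) = ac_id Y;
  ac_sum_id : forall X Y,
    ac_comp (ac_in1 X Y) (ac_pr1 X Y) + ac_comp (ac_in2 X Y) (ac_pr2 X Y)
    = ac_id (ac_sum X Y) }.

Definition cat_of (A : addcat) : category :=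
  @Category (ac_ob A) (fun X Y => ac_hom X Y : Type) (@ac_id A) (@ac_comp A)
    (@ac_comp1m A) (@ac_compm1 A) (@ac_compA A).
Coercion cat_of : addcat >-> category.

HB.instance Definition _ (A : addcat) (X Y : cat_of A) :=
  GRing.Zmodule.copy (@hom (cat_of A) X Y) (@ac_hom A X Y).

Definition zob (A : addcat) : A := ac_zero A.
Definition bisum (A : addcat) (X Y : A) : A := ac_sum X Y.
Definition in1 (A : addcat) (X Y : A) : hom X (bisum X Y) := ac_in1 X Y.
Definition in2 (A : addcat) (X Y : A) : hom Y (bisum X Y) := ac_in2 X Y.
Definition pr1 (A : addcat) (X Y : A) : hom (bisum X Y) X := ac_pr1 X Y.
Definition pr2 (A : addcat) (X Y : A) : hom (bisum X Y) Y := ac_pr2 X Y.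

Definition summ (A : addcat) (X Y X' Y' : A) (f : hom X X') (g : hom Y Y') :
    hom (bisum X Y) (bisum X' Y') :=
  in1 X' Y' \oc f \oc pr1 X Y + in2 X' Y' \oc g \oc pr2 X Y.

Definition is_zero_ob (A : addcat) (Z : A) : Prop :=
  (forall (X : A) (f : hom X Z), f = 0) /\ (forall (X : A) (f : hom Z X), f = 0).

Definition is_additive (A B : addcat) (F : functor A B) : Prop :=
  forall (X Y : A) (f g : hom X Y), fmor F (f + g) = fmor F f + fmor F g.

Definition in_ker (A B : addcat) (F : functor A B) (X : A) : Prop :=
  is_zero_ob (F X).

Section AddCatTheory.
Variable A : addcat.
Implicit Types X Y Z : A.

Lemma compDl X Y Z (g g' : hom Y Z) (f : hom X Y) :
  (g + g') \oc f = g \oc f + g' \oc f.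
Proof. exact: ac_compDl. Qed.

Lemma compDr X Y Z (g : hom Y Z) (f f' : hom X Y) :
  g \oc (f + f') = g \oc f + g \oc f'.
Proof. exact: ac_compDr. Qed.

Lemma comp0m X Y Z (f : hom X Y) : (0 : hom Y Z) \oc f = 0.
Proof. by apply: (@addrI _ (0 \oc f)); rewrite -compDl !addr0. Qed.

Lemma compm0 X Y Z (g : hom Y Z) : g \oc (0 : hom X Y) = 0.
Proof. by apply: (@addrI _ (g \oc 0)); rewrite -compDr !addr0. Qed.

Lemma compNm X Y Z (g : hom Y Z) (f : hom X Y) : (- g) \oc f = - (g \oc f).
Proof. by apply: (@addrI _ (g \oc f)); rewrite -compDl !subrr comp0m. Qed.

Lemma compmN X Y Z (g : hom Y Z) (f : hom X Y) : g \oc (- f) = - (g \oc f).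
Proof. by apply: (@addrI _ (g \oc f)); rewrite -compDr !subrr compm0. Qed.

Lemma in1pr1_in2pr2 X Y :
  in1 X Y \oc pr1 X Y + in2 X Y \oc pr2 X Y = idm (bisum X Y).
Proof. exact: ac_sum_id. Qed.

Lemma pr1in1 X Y : pr1 X Y \oc in1 X Y = idm X.
Proof. exact: ac_pr1in1. Qed.

Lemma pr2in2 X Y : pr2 X Y \oc in2 X Y = idm Y.
Proof. exact: ac_pr2in2. Qed.

Lemma idm_zob : idm (zob A) = 0.
Proof. exact: ac_zeroE. Qed.

Lemma pr1in2 X Y : pr1 X Y \oc in2 X Y = 0.
Proof.
have /(congr1 (fun h => pr1 X Y \oc (h \oc in2 X Y))) := in1pr1_in2pr2 X Y.
rewrite comp1m compDl compDr -!compA pr2in2 compm1 [pr1 X Y \oc (in1 X Y \oc _)]compA.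
by rewrite pr1in1 comp1m => /(canRL (addrK _)); rewrite subrr.
Qed.

Lemma pr2in1 X Y : pr2 X Y \oc in1 X Y = 0.
Proof.
have /(congr1 (fun h => pr2 X Y \oc (h \oc in1 X Y))) := in1pr1_in2pr2 X Y.
rewrite comp1m compDl compDr -!compA pr1in1 compm1 [pr2 X Y \oc (in2 X Y \oc _)]compA.
by rewrite pr2in2 comp1m => /(canRL (addKr _)); rewrite addNr.
Qed.

Lemma is_zero_obP X : is_zero_ob X <-> idm X = 0.
Proof.
split=> [[X0 _]|X0]; [exact: X0|split=> Y f].
  by rewrite -[f]comp1m X0 comp0m.
by rewrite -[f]compm1 X0 compm0.
Qed.

Lemma is_zero_zob : is_zero_ob (zob A).
Proof. by apply/is_zero_obP; exact: idm_zob. Qed.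
End AddCatTheory.

Lemma fmor0 (A B : addcat) (F : functor A B) (addF : is_additive F)
  (X Y : A) : fmor F (0 : hom X Y) = 0.
Proof. by apply: (@addrI _ (fmor F 0)); rewrite -addF !addr0. Qed.

(* For such N the morphisms factoring through an object of N form an ideal. *)
Definition additive_subcat (A : addcat) (N : A -> Prop) : Prop :=
  N (zob A) /\ forall X Y : A, N X -> N Y -> N (bisum X Y).

Definition factors_through (A : addcat) (N : A -> Prop) (X Y : A)
    (f : hom X Y) : Prop :=
  exists (Z : A) (u : hom X Z) (v : hom Z Y), N Z /\ f = v \oc u.

Section IdealQuotient.
Variables (A : addcat) (N : A -> Prop) (addN : additive_subcat N).

Lemma factors0 (X Y : A) : factors_through N (0 : hom X Y).
Proof. by exists (zob A), 0, 0; split; [case: addN|rewrite comp0m]. Qed.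

Lemma factorsN (X Y : A) (f : hom X Y) :
  factors_through N f -> factors_through N (- f).
Proof. by case=> Z [u [v [NZ ->]]]; exists Z, u, (- v); rewrite compNm. Qed.

Lemma factorsD (X Y : A) (f g : hom X Y) :
  factors_through N f -> factors_through N g -> factors_through N (f + g).
Proof.
case=> Z [u [v [NZ ->]]] [Z' [u' [v' [NZ' ->]]]].
exists (bisum Z Z'), (in1 Z Z' \oc u + in2 Z Z' \oc u'),
  (v \oc pr1 Z Z' + v' \oc pr2 Z Z'); split; first by case: addN => _; apply.
rewrite compDl !compDr -!compA.
rewrite [pr1 _ _ \oc (in1 _ _ \oc _)]compA [pr1 _ _ \oc (in2 _ _ \oc _)]compA.
rewrite [pr2 _ _ \oc (in1 _ _ \oc _)]compA [pr2 _ _ \oc (in2 _ _ \oc _)]compA.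
by rewrite pr1in1 pr2in2 pr1in2 pr2in1 !comp0m !compm0 !comp1m addr0 add0r.
Qed.

Lemma factors_comp (X Y Z W : A) (h : hom Z W) (g : hom Y Z) (f : hom X Y) :
  factors_through N g -> factors_through N (h \oc g \oc f).
Proof.
case=> V [u [v [NV ->]]]; exists V, (u \oc f), (h \oc v).
by split=> //; rewrite !compA.
Qed.

(* Boolean, through classical logic, as required by [equiv_rel]. *)
Definition idealr (X Y : A) (f g : hom X Y) : bool :=
  `[< factors_through N (f - g) >].

Lemma idealr_refl (X Y : A) : reflexive (@idealr X Y).
Proof. by move=> f; apply/asboolP; rewrite subrr; exact: factors0. Qed.

Lemma idealr_sym (X Y : A) : symmetric (@idealr X Y).
Proof.
by move=> f g; apply/asboolP/asboolP => /factorsN; rewrite opprB.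
Qed.

Lemma idealr_trans (X Y : A) : transitive (@idealr X Y).
Proof.
move=> g f h /asboolP fg /asboolP gh; apply/asboolP.
by have := factorsD fg gh; rewrite addrA subrK.
Qed.

Definition ideal_equiv (X Y : A) : equiv_rel (hom X Y) :=
  EquivRel (@idealr X Y) (@idealr_refl X Y) (@idealr_sym X Y)
    (@idealr_trans X Y).

Definition qhom (X Y : A) : Type := {eq_quot (ideal_equiv X Y)}.

Definition qpi (X Y : A) (f : hom X Y) : qhom X Y :=
  (\pi_({eq_quot (ideal_equiv X Y)}) f)%qT.

Definition qrepr (X Y : A) (f : qhom X Y) : hom X Y :=
  repr (f : {eq_quot (ideal_equiv X Y)}).

Lemma qreprK (X Y : A) (f : qhom X Y) : qpi (qrepr f) = f.
Proof. exact: reprK. Qed.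

Lemma qpiP (X Y : A) (f g : hom X Y) :
  qpi f = qpi g <-> factors_through N (f - g).
Proof.
by split=> [/eqmodP/asboolP //|fg]; apply/eqmodP/asboolP.
Qed.

Definition qcomp (X Y Z : A) (g : qhom Y Z) (f : qhom X Y) : qhom X Z :=
  qpi (qrepr g \oc qrepr f).

Lemma qpi_comp (X Y Z : A) (g : hom Y Z) (f : hom X Y) :
  qpi (g \oc f) = qcomp (qpi g) (qpi f).
Proof.
apply/qpiP; set g' := qrepr _; set f' := qrepr _.
have fg : factors_through N (g - g') by apply/qpiP; rewrite qreprK.
have ff : factors_through N (f - f') by apply/qpiP; rewrite qreprK.
have -> : g \oc f - g' \oc f'
    = idm Z \oc (g - g') \oc f + g' \oc (f - f') \oc idm X.
  by rewrite comp1m compm1 compDl compDr compNm compmN addrA subrK.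
by apply: factorsD; apply: factors_comp.
Qed.

Lemma qcomp1m (X Y : A) (f : qhom X Y) : qcomp (qpi (idm Y)) f = f.
Proof. by rewrite -[f]qreprK -qpi_comp comp1m. Qed.

Lemma qcompm1 (X Y : A) (f : qhom X Y) : qcomp f (qpi (idm X)) = f.
Proof. by rewrite -[f]qreprK -qpi_comp compm1. Qed.

Lemma qcompA (X Y Z W : A) (h : qhom Z W) (g : qhom Y Z) (f : qhom X Y) :
  qcomp h (qcomp g f) = qcomp (qcomp h g) f.
Proof. by rewrite -[h]qreprK -[g]qreprK -[f]qreprK -!qpi_comp compA. Qed.

(* Only the underlying category of A/[N] is needed to localize it. *)
Definition ideal_quotient : category :=
  @Category (ob A) qhom (fun X => qpi (idm X)) qcomp qcomp1m qcompm1 qcompA.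

Definition quotient_functor : functor A ideal_quotient :=
  @Functor A ideal_quotient (fun X => X) qpi (fun X => erefl) qpi_comp.
End IdealQuotient.

(* An additive bifunctor E : C^op x C -> Ab; [E Z X] stands for E(Z,X),
   [push a] for a_* and [pull c] for c^*. *)
Record addbifunctor (C : addcat) := AddBifunctor {
  ext :> C -> C -> zmodType;
  push : forall (Z X X' : C), hom X X' -> ext Z X -> ext Z X';
  pull : forall (Z' Z X : C), hom Z' Z -> ext Z X -> ext Z' X;
  push_id : forall (Z X : C) (d : ext Z X), push (idm X) d = d;
  push_comp : forall (Z X X' X'' : C) (a' : hom X' X'') (a : hom X X')
    (d : ext Z X), push (a' \oc a) d = push a' (push a d);
  pull_id : forall (Z X : C) (d : ext Z X), pull (idm Z) d = d;
  pull_comp : forall (Z'' Z' Z X : C) (c : hom Z' Z) (c' : hom Z'' Z')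
    (d : ext Z X), pull (c \oc c') d = pull c' (pull c d);
  push_pull : forall (Z' Z X X' : C) (c : hom Z' Z) (a : hom X X')
    (d : ext Z X), push a (pull c d) = pull c (push a d);
  pushD : forall (Z X X' : C) (a : hom X X') (d d' : ext Z X),
    push a (d + d') = push a d + push a d';
  pullD : forall (Z' Z X : C) (c : hom Z' Z) (d d' : ext Z X),
    pull c (d + d') = pull c d + pull c d';
  pushDm : forall (Z X X' : C) (a a' : hom X X') (d : ext Z X),
    push (a + a') d = push a d + push a' d;
  pullDm : forall (Z' Z X : C) (c c' : hom Z' Z) (d : ext Z X),
    pull (c + c') d = pull c d + pull c' d }.

Arguments push {_ _} {Z X X'} _ _.
Arguments pull {_ _} {Z' Z X} _ _.

(* The element of E(Z (+) Z', X (+) X') with components (d, 0, 0, d'). *)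
Definition ext_sum (C : addcat) (E : addbifunctor C) (Z X Z' X' : C)
    (d : E Z X) (d' : E Z' X') : E (bisum Z Z') (bisum X X') :=
  push (in1 X X') (pull (pr1 Z Z') d) + push (in2 X X') (pull (pr2 Z Z') d').

Definition seq_equiv (C : category) (X Y Y' Z : C) (x : hom X Y) (y : hom Y Z)
    (x' : hom X Y') (y' : hom Y' Z) : Prop :=
  exists b : hom Y Y', is_iso b /\ b \oc x = x' /\ y' \oc b = y.

Section ExtriangulatedAxioms.
Variables (C : addcat) (E : addbifunctor C).

(* [s d x y] says that the sequence (x, y) belongs to the class s(d). *)
Variable s : forall Z X : C, E Z X ->
  forall Y : C, hom X Y -> hom Y Z -> Prop.

Definition realization_class : Prop :=
  forall (Z X : C) (d : E Z X),
    exists (Y : C) (x : hom X Y) (y : hom Y Z),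
      forall (Y' : C) (x' : hom X Y') (y' : hom Y' Z),
        s d x' y' <-> seq_equiv x y x' y'.

Definition realization_morphism : Prop :=
  forall (X Y Z X' Y' Z' : C) (d : E Z X) (d' : E Z' X')
    (x : hom X Y) (y : hom Y Z) (x' : hom X' Y') (y' : hom Y' Z')
    (a : hom X X') (c : hom Z Z'),
    s d x y -> s d' x' y' -> push a d = pull c d' ->
    exists b : hom Y Y', b \oc x = x' \oc a /\ y' \oc b = c \oc y.

Definition realization_split : Prop :=
  forall X Z : C, s (0 : E Z X) (in1 X Z) (pr2 X Z).

Definition realization_sum : Prop :=
  forall (X Y Z X' Y' Z' : C) (d : E Z X) (d' : E Z' X')
    (x : hom X Y) (y : hom Y Z) (x' : hom X' Y') (y' : hom Y' Z'),
    s d x y -> s d' x' y' -> s (ext_sum d d') (summ x x') (summ y y').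

Definition ET3 : Prop :=
  forall (X Y Z X' Y' Z' : C) (d : E Z X) (d' : E Z' X')
    (x : hom X Y) (y : hom Y Z) (x' : hom X' Y') (y' : hom Y' Z')
    (a : hom X X') (b : hom Y Y'),
    s d x y -> s d' x' y' -> b \oc x = x' \oc a ->
    exists c : hom Z Z', c \oc y = y' \oc b /\ push a d = pull c d'.

Definition ET3op : Prop :=
  forall (X Y Z X' Y' Z' : C) (d : E Z X) (d' : E Z' X')
    (x : hom X Y) (y : hom Y Z) (x' : hom X' Y') (y' : hom Y' Z')
    (b : hom Y Y') (c : hom Z Z'),
    s d x y -> s d' x' y' -> c \oc y = y' \oc b ->
    exists a : hom X X', b \oc x = x' \oc a /\ push a d = pull c d'.

Definition ET4 : Prop :=
  forall (A B D K F : C) (d1 : E D A) (d2 : E F B)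
    (f : hom A B) (f' : hom B D) (g : hom B K) (g' : hom K F),
    s d1 f f' -> s d2 g g' ->
    exists (W : C) (h' : hom K W) (d3 : E W A) (d : hom D W) (e : hom W F),
      s d3 (g \oc f) h' /\ h' \oc g = d \oc f' /\ e \oc h' = g'
      /\ s (push f' d2) d e
      /\ pull d d3 = d1 /\ push f d3 = pull e d2.

(* Dual of ET4, for the conflations  D -> A -> B  and  F -> B -> K. *)
Definition ET4op : Prop :=
  forall (A B D K F : C) (d1 : E B D) (d2 : E K F)
    (f' : hom D A) (f : hom A B) (g' : hom F B) (g : hom B K),
    s d1 f' f -> s d2 g' g ->
    exists (W : C) (h' : hom W A) (d3 : E K W) (d : hom D W) (e : hom W F),
      s d3 h' (g \oc f) /\ f \oc h' = g' \oc e /\ h' \oc d = f'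
      /\ s (pull g' d1) d e
      /\ push e d3 = d2 /\ push d d1 = pull g d3.
End ExtriangulatedAxioms.

Record extricat := ExtriCat {
  ex_add :> addcat;
  EE : addbifunctor ex_add;
  realizes : forall Z X : ex_add, EE Z X ->
    forall Y : ex_add, hom X Y -> hom Y Z -> Prop;
  ex_class : realization_class realizes;
  ex_morphism : realization_morphism realizes;
  ex_split : realization_split realizes;
  ex_sum : realization_sum realizes;
  ex_ET3 : ET3 realizes;
  ex_ET3op : ET3op realizes;
  ex_ET4 : ET4 realizes;
  ex_ET4op : ET4op realizes }.

Arguments EE {_}.
Arguments realizes {_ Z X} _ {Y} _ _.

Section Conflations.
Variable C : extricat.
Implicit Types X Y Z : C.

Definition is_conflation X Y Z (x : hom X Y) (y : hom Y Z) : Prop :=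
  exists d : EE Z X, realizes d x y.

Definition is_inflation X Y (x : hom X Y) : Prop :=
  exists (Z : C) (y : hom Y Z), is_conflation x y.

Definition is_deflation Y Z (y : hom Y Z) : Prop :=
  exists (X : C) (x : hom X Y), is_conflation x y.

Definition is_cone X Y (x : hom X Y) (Z : C) : Prop :=
  exists y : hom Y Z, is_conflation x y.

Definition is_cocone Y Z (y : hom Y Z) (X : C) : Prop :=
  exists x : hom X Y, is_conflation x y.

Definition right_s_exact X Y Z (f : hom X Y) (g : hom Y Z) : Prop :=
  exists (K : C) (h2 : hom K Y) (h1 : hom X K),
    is_conflation h2 g /\ is_deflation h1 /\ f = h2 \oc h1.

Definition left_s_exact X Y Z (f : hom X Y) (g : hom Y Z) : Prop :=
  exists (K : C) (h1 : hom Y K) (h2 : hom K Z),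
    is_conflation f h1 /\ is_inflation h2 /\ g = h2 \oc h1.
End Conflations.

Definition exact_transfo (A B : extricat) (F : functor A B)
    (eta : forall Z X : A, EE Z X -> EE (F Z) (F X)) : Prop :=
  (forall (Z X : A) (d d' : EE Z X), eta Z X (d + d') = eta Z X d + eta Z X d')
  /\ (forall (Z X X' : A) (a : hom X X') (d : EE Z X),
        eta Z X' (push a d) = push (fmor F a) (eta Z X d))
  /\ (forall (Z' Z X : A) (c : hom Z' Z) (d : EE Z X),
        eta Z' X (pull c d) = pull (fmor F c) (eta Z X d))
  /\ (forall (X Y Z : A) (d : EE Z X) (x : hom X Y) (y : hom Y Z),
        realizes d x y -> realizes (eta Z X d) (fmor F x) (fmor F y)).

Definition is_exact (A B : extricat) (F : functor A B) : Prop :=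
  is_additive F /\
  exists eta : forall Z X : A, EE Z X -> EE (F Z) (F X), exact_transfo eta.

Record exact_functor (A B : extricat) := ExactFunctor {
  ef_fun :> functor A B;
  ef_additive : is_additive ef_fun;
  ef_eta : forall Z X : A, EE Z X -> EE (ef_fun Z) (ef_fun X);
  ef_exact : exact_transfo ef_eta }.

Arguments ef_eta {_ _} _ {Z X} _.

Section CompExact.
Variables (A B C : extricat) (G : exact_functor B C) (F : exact_functor A B).

Lemma comp_additive : is_additive (comp_functor G F).
Proof. by move=> X Y f g /=; rewrite (ef_additive F) (ef_additive G). Qed.

Lemma comp_exact :
  @exact_transfo A C (comp_functor G F) (fun Z X d => ef_eta G (ef_eta F d)).
Proof.
have [FD [Fa [Fc Fr]]] := ef_exact F.
have [GD [Ga [Gc Gr]]] := ef_exact G.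
split; first by move=> Z X d d'; rewrite FD GD.
split; first by move=> Z X X' a d; rewrite Fa Ga.
split; first by move=> Z' Z X c d; rewrite Fc Gc.
by move=> X Y Z d x y /Fr/Gr.
Qed.

Definition comp_exact_functor : exact_functor A C :=
  ExactFunctor comp_additive comp_exact.
End CompExact.

Record s_recollement (A B C : extricat) := SRecollement {
  i_lower : functor A B;      (* i_* *)
  i_upper : functor B A;      (* i^* *)
  i_shriek : functor B A;     (* i^! *)
  j_upper : functor B C;      (* j^* *)
  j_shriek : functor C B;     (* j_! *)
  j_lower : functor C B;      (* j_* *)
  i_lower_add : is_additive i_lower;
  i_upper_add : is_additive i_upper;
  i_shriek_add : is_additive i_shriek;
  j_upper_add : is_additive j_upper;
  j_shriek_add : is_additive j_shriek;
  j_lower_add : is_additive j_lower;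
  adj_iu_il : adjunction i_upper i_lower;
  adj_il_is : adjunction i_lower i_shriek;
  adj_js_ju : adjunction j_shriek j_upper;
  adj_ju_jl : adjunction j_upper j_lower;
  i_lower_exact : is_exact i_lower;
  j_upper_exact : is_exact j_upper;
  j_upper_i_lower : forall X : A, is_zero_ob (j_upper (i_lower X));
  i_lower_ff : fully_faithful i_lower;
  j_shriek_ff : fully_faithful j_shriek;
  j_lower_ff : fully_faithful j_lower;
  sr4_left : forall X : B,
    left_s_exact (adj_counit adj_il_is X) (adj_unit adj_ju_jl X);
  sr4_right : forall X : B,
    right_s_exact (adj_counit adj_js_ju X) (adj_unit adj_iu_il X);
  (* Cones and cocones are only defined up to isomorphism; they exist here by
     [sr4_left] and [sr4_right]. *)
  sr4_cone : forall X K : B,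
    is_cone (adj_counit adj_il_is X) K -> in_ker i_shriek K;
  sr4_cocone : forall X K : B,
    is_cocone (adj_unit adj_iu_il X) K -> in_ker i_upper K;
  sr5 :
    (forall X : B, in_ker i_shriek X -> in_ker j_upper X -> is_zero_ob X)
    \/ (forall X : B, in_ker i_upper X -> in_ker j_upper X -> is_zero_ob X) }.

Definition null_ob (B : addcat) (I : mclass B) (N : B) : Prop :=
  I N (zob B) 0 /\ I (zob B) N 0.

(* The last condition ensures that the morphisms factoring through an object
   of N_I form an ideal, so that B/[N_I] is defined. *)
Record loc_class (B : addcat) := LocClass {
  lc_class :> mclass B;
  lc_id : forall X : B, lc_class (idm X);
  lc_comp : forall (X Y Z : B) (g : hom Y Z) (f : hom X Y),
    lc_class g -> lc_class f -> lc_class (g \oc f);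
  lc_null : additive_subcat (null_ob lc_class) }.

Section Localization.
Variables (B : addcat) (I : loc_class B).

Definition bar_cat : category := ideal_quotient (lc_null I).
Definition bar_functor : functor B bar_cat := quotient_functor (lc_null I).

(* The closure of p(I) under composition with isomorphisms of B/[N_I]. *)
Inductive bar_class : forall X Y : bar_cat, hom X Y -> Prop :=
| bar_class_image (X Y : B) (f : hom X Y) :
    lc_class I f -> @bar_class X Y (fmor bar_functor f)
| bar_class_isol (X Y Z : bar_cat) (u : hom Y Z) (f : hom X Y) :
    is_iso u -> bar_class f -> bar_class (u \oc f)
| bar_class_isor (X Y Z : bar_cat) (f : hom Y Z) (u : hom X Y) :
    is_iso u -> bar_class f -> bar_class (f \oc u).
End Localization.

(* [el_category] describes the category underlying [Bt]; [el_universal] pins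
   down its extriangulated structure, which [el_category] does not. *)
Record is_extri_localization (B Bt : extricat) (I : loc_class B)
    (Q : exact_functor B Bt) : Prop := {
  el_category : exists L : functor (bar_cat I) Bt,
    is_localization_at (@bar_class B I) L
    /\ comp_functor L (bar_functor I) = Q;
  el_universal : forall (D : extricat) (G : exact_functor B D), inverts I G ->
    exists! Gt : exact_functor Bt D, comp_exact_functor Gt Q = G }.

Section InvertedClass.
Variables (B C : addcat) (F : functor B C) (addF : is_additive F).

Let I : mclass B := preim_class F (@iso_class C).

Lemma preim_iso_id (X : B) : I (idm X).
Proof. by exists (idm (F X)); rewrite fmor_id comp1m. Qed.

Lemma preim_iso_comp (X Y Z : B) (g : hom Y Z) (f : hom X Y) :
  I g -> I f -> I (g \oc f).
Proof.
move=> [g' [g'g gg']] [f' [f'f ff']]; exists (f' \oc g').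
rewrite fmor_comp; split.
  by rewrite -compA [g' \oc (_ \oc _)]compA g'g comp1m.
by rewrite -compA [fmor F f \oc (_ \oc _)]compA ff' comp1m.
Qed.

Lemma preim_iso_nullP (X : B) : null_ob I X <-> is_zero_ob (F X).
Proof.
split=> [[[h [hX _]] _]|FX].
  by apply/is_zero_obP; rewrite -hX (fmor0 addF) compm0.
have F0 : is_zero_ob (F (zob B)).
  by apply/is_zero_obP; rewrite -fmor_id idm_zob (fmor0 addF).
move/is_zero_obP: FX => FX; move/is_zero_obP: F0 => F0.
by split; exists 0; rewrite (fmor0 addF) !comp0m FX F0.
Qed.

Lemma preim_iso_null : additive_subcat (null_ob I).
Proof.
split=> [|X Y /preim_iso_nullP/is_zero_obP X0 /preim_iso_nullP/is_zero_obP Y0].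
  by apply/preim_iso_nullP/is_zero_obP; rewrite -fmor_id idm_zob (fmor0 addF).
apply/preim_iso_nullP/is_zero_obP.
rewrite -fmor_id -in1pr1_in2pr2 addF !fmor_comp.
rewrite -[fmor F (pr1 X Y)]comp1m -[fmor F (pr2 X Y)]comp1m X0 Y0.
by rewrite !comp0m !compm0 addr0.
Qed.

Definition inverted_class : loc_class B :=
  LocClass preim_iso_id preim_iso_comp preim_iso_null.
End InvertedClass.

(* Main.v *)
From mathcomp Require Import all_boot ssralg.
From mathcomp Require Import boolp.
Require Import Defs.

Set Implicit Arguments.
Unset Strict Implicit.
Unset Printing Implicit Defensive.

Import GRing.Theory.
Local Open Scope ring_scope.

(** The functor [j^*] is a reflection: its right adjoint [j_*] is fully faithful.
    A reflector exhibits its target as the localization of its source at the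
    morphisms that it inverts, and [Q] is another localization at this class.

    Since [j^*] is additive and kills the null objects, it descends to the ideal
    quotient ([descend]); the descended functor inverts the closure of the image
    of [I] ([bar_class_inverted]), so it factors through the localization.  Both
    steps are strictly unique ([quotient_functor_epi] and the universal property
    of the localization), which gives existence and uniqueness of [jt].

    The quasi-inverse of [jt] is [Q j_*].  On one side
    [jt Q j_* = j^* j_*] is isomorphic to the identity by the counit, which is
    invertible because [j_*] is fully faithful ([counit_iso]).  On the other
    side, the triangle identity makes [j^*] of the unit [eta_X : X -> j_* j^* X]
    invertible ([reflection_unit_iso]); hence [eta] lies in [I] and [Q eta] is a
    natural isomorphism from [Q] to [Q j_* j^* = (Q j_* jt) Q].  It remains to
    cancel [Q] on the right of a natural isomorphism.  For the ideal quotient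
    this is clear, as it is the identity on objects and full
    ([natiso_quotient]).  For the localization [L], a natural isomorphism from
    [F L] to [G L] is the same thing as a functor to the category of
    isomorphisms of the target; that functor factors through [L], and the
    factorization is an isomorphism from [F] to [G]
    ([natiso_localization]). *)

(** * Isomorphisms and natural isomorphisms *)

Section Isomorphisms.
Variable C : category.

Lemma iso_id (X : C) : is_iso (idm X).
Proof. by exists (idm X); rewrite comp1m. Qed.

Lemma iso_comp (X Y Z : C) (g : hom Y Z) (f : hom X Y) :
  is_iso g -> is_iso f -> is_iso (g \oc f).
Proof.
move=> [g' [g'g gg']] [f' [f'f ff']]; exists (f' \oc g'); split.
  by rewrite -compA [g' \oc _]compA g'g comp1m.
by rewrite -compA [f \oc _]compA ff' comp1m.
Qed.

Lemma iso_right_factor (X Y Z : C) (g : hom Y Z) (f : hom X Y) :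
  is_iso g -> is_iso (g \oc f) -> is_iso f.
Proof.
move=> [g' [g'g gg']] gf_iso.
rewrite -[f]comp1m -g'g -compA; apply: iso_comp => //.
by exists g.
Qed.
End Isomorphisms.

Lemma fmor_iso (C D : category) (F : functor C D) (X Y : C) (f : hom X Y) :
  is_iso f -> is_iso (fmor F f).
Proof.
by case=> g [gf fg]; exists (fmor F g); rewrite -!fmor_comp gf fg !fmor_id.
Qed.

Lemma inverts_comp (C D E : category) (W : mclass C) (G : functor D E)
    (F : functor C D) :
  inverts W F -> inverts W (comp_functor G F).
Proof. by move=> invF X Y f Wf; apply: (fmor_iso G); exact: invF. Qed.

(** Both functors have the same object map by construction, so that the equation
    on morphisms is well typed without transport. *)
Lemma functor_ext (C D : category) (F : functor C D)
    (m : forall X Y : C, hom X Y -> hom (F X) (F Y))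
    (m_id : forall X, m X X (idm X) = idm (F X))
    (m_comp : forall X Y Z (g : hom Y Z) (f : hom X Y),
       m X Z (g \oc f) = m Y Z g \oc m X Y f) :
  (forall X Y (f : hom X Y), m X Y f = fmor F f) -> Functor m_id m_comp = F.
Proof.
move=> mF; have E : m = @fmor _ _ F.
  by do 3!apply: functional_extensionality_dep => ?; exact: mF.
subst m; case: F m_id m_comp {mF} => o m m1 m2 /= c1 c2.
by congr Functor; exact: Prop_irrelevance.
Qed.

Lemma comp_functorA (C D E T : category) (H : functor E T) (G : functor D E)
    (F : functor C D) :
  comp_functor (comp_functor H G) F = comp_functor H (comp_functor G F).
Proof. exact: (functor_ext (F := comp_functor H (comp_functor G F))). Qed.

Lemma comp_id_functor (C D : category) (F : functor C D) :
  comp_functor (id_functor D) F = F.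
Proof. exact: (functor_ext (F := F)). Qed.

Lemma natiso_sym (C D : category) (F G : functor C D) :
  naturally_isomorphic F G -> naturally_isomorphic G F.
Proof.
case=> al [nat_al iso_al].
pose be X := sval (cid (iso_al X)).
have beP X : be X \oc al X = idm (F X) /\ al X \oc be X = idm (G X).
  exact: (svalP (cid (iso_al X))).
exists be; split=> [X Y f|X]; last by exists (al X); have [] := beP X.
have [_ aX] := beP X; have [bY _] := beP Y.
rewrite -[LHS]compm1 -aX compA -[be Y \oc _ \oc _]compA -nat_al compA bY.
by rewrite comp1m.
Qed.

(** * Cancelling a localization on the right *)

Section IsoCategory.
Variable T : category.

Record iso_ob := IsoOb {
  io_dom : T; io_cod : T; io_map : hom io_dom io_cod; io_iso : is_iso io_map }.

Definition iso_hom (a b : iso_ob) : Type :=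
  {h : hom (io_dom a) (io_dom b) * hom (io_cod a) (io_cod b)
     | io_map b \oc h.1 = h.2 \oc io_map a}.

Lemma iso_hom_eq (a b : iso_ob) (h k : iso_hom a b) :
  (sval h).1 = (sval k).1 -> (sval h).2 = (sval k).2 -> h = k.
Proof.
case: h k => [[h1 h2] hP] [[k1 k2] kP] /= e1 e2.
by subst k1 k2; congr exist; exact: Prop_irrelevance.
Qed.

Lemma iso_idP (a : iso_ob) :
  io_map a \oc idm (io_dom a) = idm (io_cod a) \oc io_map a.
Proof. by rewrite comp1m compm1. Qed.

Definition iso_idm (a : iso_ob) : iso_hom a a :=
  exist _ (idm (io_dom a), idm (io_cod a)) (iso_idP a).

Lemma iso_compP (a b c : iso_ob) (k : iso_hom b c) (h : iso_hom a b) :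
  io_map c \oc ((sval k).1 \oc (sval h).1)
  = (sval k).2 \oc (sval h).2 \oc io_map a.
Proof. by rewrite compA (svalP k) -compA (svalP h) compA. Qed.

Definition iso_compm (a b c : iso_ob) (k : iso_hom b c) (h : iso_hom a b) :
  iso_hom a c :=
  exist _ ((sval k).1 \oc (sval h).1, (sval k).2 \oc (sval h).2)
    (iso_compP k h).

Lemma iso_comp1m a b (h : iso_hom a b) : iso_compm (iso_idm b) h = h.
Proof. by apply: iso_hom_eq; rewrite /= comp1m. Qed.

Lemma iso_compm1 a b (h : iso_hom a b) : iso_compm h (iso_idm a) = h.
Proof. by apply: iso_hom_eq; rewrite /= compm1. Qed.

Lemma iso_compA a b c d (l : iso_hom c d) (k : iso_hom b c) (h : iso_hom a b) :
  iso_compm l (iso_compm k h) = iso_compm (iso_compm l k) h.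
Proof. by apply: iso_hom_eq; rewrite /= compA. Qed.

(** The full subcategory of the arrow category on the isomorphisms.  Keeping
    only isomorphisms makes its two projections [iso_domF] and [iso_codF]
    isomorphic, and not merely related by a natural transformation. *)
Definition iso_category : category :=
  @Category iso_ob iso_hom iso_idm iso_compm iso_comp1m iso_compm1 iso_compA.

Definition iso_domF : functor iso_category T :=
  @Functor iso_category T io_dom (fun a b h => (sval h).1)
    (fun a => erefl) (fun a b c k h => erefl).

Definition iso_codF : functor iso_category T :=
  @Functor iso_category T io_cod (fun a b h => (sval h).2)
    (fun a => erefl) (fun a b c k h => erefl).

Lemma iso_category_iso (a b : iso_category) (h : hom a b) :
  is_iso (fmor iso_domF h) -> is_iso (fmor iso_codF h) -> is_iso h.
Proof.
move=> [d [dh hd]] [c [ch hc]].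
have dcP : io_map a \oc d = c \oc io_map b.
  rewrite -[LHS]comp1m -ch -compA; congr (_ \oc _).
  by rewrite compA /= -(svalP h) -compA; rewrite /= in hd; rewrite hd compm1.
exists (exist _ (d, c) dcP : iso_hom b a).
by split; apply: iso_hom_eq.
Qed.

Lemma natiso_iso_dom_cod (C : category) (H : functor C iso_category) :
  naturally_isomorphic (comp_functor iso_domF H) (comp_functor iso_codF H).
Proof.
exists (fun X => io_map (H X)); split=> [X Y f|X]; last exact: io_iso.
exact: (svalP (fmor H f)).
Qed.

(** Naturality of the isomorphism says precisely that each pair [(F f, G f)] is a
    morphism of [iso_category]. *)
Lemma natiso_functor (C : category) (F G : functor C T) :
  naturally_isomorphic F G ->
  exists K : functor C iso_category,
    comp_functor iso_domF K = F /\ comp_functor iso_codF K = G.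
Proof.
case=> al [nat_al iso_al].
pose Kob X : iso_category := IsoOb (iso_al X).
pose Kmor X Y (f : hom X Y) : hom (Kob X) (Kob Y) :=
  exist _ (fmor F f, fmor G f) (nat_al X Y f).
have K1 X : Kmor X X (idm X) = idm (Kob X).
  by apply: iso_hom_eq; rewrite /= fmor_id.
have KM X Y Z (g : hom Y Z) (f : hom X Y) :
    Kmor X Z (g \oc f) = Kmor Y Z g \oc Kmor X Y f.
  by apply: iso_hom_eq; rewrite /= fmor_comp.
exists (Functor K1 KM); split.
  exact: (functor_ext (F := F)).
exact: (functor_ext (F := G)).
Qed.
End IsoCategory.

(** Both functors solve the factorization problem posed by their common
    composite with [L], which has a single solution. *)
Lemma localization_epi (C D T : category) (W : mclass C) (L : functor C D)
    (F G : functor D T) :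
  is_localization_at W L -> comp_functor F L = comp_functor G L -> F = G.
Proof.
move=> [invL univL] FG.
have [H [_ uniH]] := univL T _ (inverts_comp F invL).
by rewrite -(uniH F erefl) -(uniH G (esym FG)).
Qed.

(** The universal property is applied to functors with values in [iso_category],
    instead of extending the components along [L]: the objects of [D] are not
    known to be values of [L]. *)
Lemma natiso_localization (C D T : category) (W : mclass C) (L : functor C D)
    (F G : functor D T) :
  is_localization_at W L ->
  naturally_isomorphic (comp_functor F L) (comp_functor G L) ->
  naturally_isomorphic F G.
Proof.
move=> locL /natiso_functor[K [domK codK]].
have [invL univL] := locL.
have inv_dom : inverts W (comp_functor (iso_domF T) K).
  by rewrite domK; exact: inverts_comp.
have inv_cod : inverts W (comp_functor (iso_codF T) K).
  by rewrite codK; exact: inverts_comp.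
have invK : inverts W K.
  by move=> X Y f Wf; apply: iso_category_iso; [exact: inv_dom|exact: inv_cod].
have [H [HL _]] := univL _ K invK.
have -> : F = comp_functor (iso_domF T) H.
  by apply: (localization_epi locL); rewrite comp_functorA HL.
have -> : G = comp_functor (iso_codF T) H.
  by apply: (localization_epi locL); rewrite comp_functorA HL.
exact: natiso_iso_dom_cod.
Qed.

(** * Functors out of an ideal quotient *)

Section Quotient.
Variables (A : addcat) (N : A -> Prop) (addN : additive_subcat N).
Variable T : category.
Let p : functor A (ideal_quotient addN) := quotient_functor addN.

Lemma natiso_quotient (F G : functor (ideal_quotient addN) T) :
  naturally_isomorphic (comp_functor F p) (comp_functor G p) ->
  naturally_isomorphic F G.
Proof.
case=> al [nat_al iso_al]; exists al; split=> // X Y f.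
by rewrite -[f]qreprK; exact: nat_al.
Qed.

Section Descend.
Variable F : functor A T.
Hypothesis FN : forall (X Y : A) (f g : hom X Y),
  factors_through N (f - g) -> fmor F f = fmor F g.

Lemma descend_qpi (X Y : A) (f : hom X Y) :
  fmor F (qrepr (qpi addN f)) = fmor F f.
Proof. by apply/FN/(qpiP addN); rewrite qreprK. Qed.

Lemma descend_id (X : A) : fmor F (qrepr (qpi addN (idm X))) = idm (F X).
Proof. by rewrite descend_qpi fmor_id. Qed.

Lemma descend_comp (X Y Z : A) (g : qhom addN Y Z) (f : qhom addN X Y) :
  fmor F (qrepr (qcomp g f)) = fmor F (qrepr g) \oc fmor F (qrepr f).
Proof. by rewrite descend_qpi fmor_comp. Qed.

Definition descend : functor (ideal_quotient addN) T :=
  @Functor (ideal_quotient addN) T F (fun X Y f => fmor F (qrepr f))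
    descend_id descend_comp.

Lemma descend_quotient : comp_functor descend p = F.
Proof. by apply: (functor_ext (F := F)) => X Y f; exact: descend_qpi. Qed.
End Descend.

Lemma descend_comp_quotient (G : functor (ideal_quotient addN) T)
    (GN : forall (X Y : A) (f g : hom X Y), factors_through N (f - g) ->
       fmor (comp_functor G p) f = fmor (comp_functor G p) g) :
  descend GN = G.
Proof. by apply: (functor_ext (F := G)) => X Y f; rewrite /= qreprK. Qed.

(** Each functor on the quotient is recovered from its composite with [p] by
    [descend]; this also settles strict equality of the values on objects. *)
Lemma quotient_functor_epi (F G : functor (ideal_quotient addN) T) :
  comp_functor F p = comp_functor G p -> F = G.
Proof.
move=> FG.
have kill (H : functor (ideal_quotient addN) T) (X Y : A) (f g : hom X Y) :
    factors_through N (f - g) ->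
    fmor (comp_functor H p) f = fmor (comp_functor H p) g.
  by move=> /(qpiP addN) /= ->.
rewrite -(descend_comp_quotient (kill F)) -(descend_comp_quotient (kill G)).
move: (kill F) (kill G); rewrite FG => k1 k2.
by rewrite (Prop_irrelevance k1 k2).
Qed.
End Quotient.

(** * Functors out of the localization by a class of morphisms *)

Lemma bar_class_inverted (B : addcat) (I : loc_class B) (T : category)
    (F : functor (bar_cat I) T) :
  inverts I (comp_functor F (bar_functor I)) -> inverts (@bar_class B I) F.
Proof.
move=> invF X Y f.
elim=> {X Y f} [X Y f /invF //|X Y Z u f iu _ IH|X Y Z f u iu _ IH].
  by rewrite fmor_comp; apply: iso_comp => //; exact: fmor_iso.
by rewrite fmor_comp; apply: iso_comp => //; exact: fmor_iso.
Qed.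

Lemma additive_kills (A B : addcat) (F : functor A B) (N : A -> Prop) :
  is_additive F -> (forall X, N X -> is_zero_ob (F X)) ->
  forall (X Y : A) (f g : hom X Y),
    factors_through N (f - g) -> fmor F f = fmor F g.
Proof.
move=> addF FN X Y f g [Z [u [v [/FN[FZ0 _] fg]]]].
rewrite -[f](subrK g) addF fg fmor_comp [fmor F u]FZ0 compm0.
exact: add0r.
Qed.

(** * Reflections *)

Section Reflection.
Variables (B C : category) (L : functor B C) (R : functor C B).
Variables (adj : adjunction L R) (ffR : fully_faithful R).

(** The inverse of the counit at [Y] is the preimage under [R] of the unit at
    [R Y]. *)
Lemma counit_iso (Y : C) : is_iso (adj_counit adj Y).
Proof.
have [preR _ preRK] := ffR Y (L (R Y)).
pose h := preR (adj_unit adj (R Y)).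
have Rh : fmor R h = adj_unit adj (R Y) by exact: preRK.
exists h; split.
  by rewrite -adj_counit_nat Rh adj_triangleL.
apply: (bij_inj (ffR Y Y)).
by rewrite fmor_comp Rh adj_triangleR fmor_id.
Qed.

(** By a triangle identity, the invertible counit is its left inverse. *)
Lemma reflection_unit_iso (X : B) : is_iso (fmor L (adj_unit adj X)).
Proof.
apply: (iso_right_factor (counit_iso (L X))).
rewrite adj_triangleL; exact: iso_id.
Qed.

Lemma natiso_counit : naturally_isomorphic (comp_functor L R) (id_functor C).
Proof.
exists (adj_counit adj); split; [exact: adj_counit_nat|exact: counit_iso].
Qed.

(** The components are the values of [Q] at the units of the reflection: [L]
    inverts them, hence so does [Q]. *)
Lemma natiso_reflection (T : category) (Q : functor B T) :
  inverts (preim_class L (@iso_class C)) Q ->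
  naturally_isomorphic Q (comp_functor (comp_functor Q R) L).
Proof.
move=> invQ; exists (fun X => fmor Q (adj_unit adj X)); split=> [X Y f|X].
  by rewrite -fmor_comp adj_unit_nat fmor_comp.
exact/invQ/reflection_unit_iso.
Qed.
End Reflection.

(** * The comparison equivalence *)

Theorem proposition4p11 (A B C : extricat) (R : s_recollement A B C)
    (Bt : extricat) (Q : exact_functor B Bt)
    (HQ : is_extri_localization (inverted_class (j_upper_add R)) Q) :
  exists! jt : functor Bt C,
    is_equivalence jt /\ j_upper R = comp_functor jt Q.
Proof.
set I := inverted_class _ in HQ.
have [[L [locL LQ]] _] := HQ.
have cancelQ (T : category) (F G : functor Bt T) :
    comp_functor F Q = comp_functor G Q -> F = G.
  rewrite -LQ -!comp_functorA => /quotient_functor_epi.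
  exact: (localization_epi locL).
have natiso_cancelQ (T : category) (F G : functor Bt T) :
    naturally_isomorphic (comp_functor F Q) (comp_functor G Q) ->
    naturally_isomorphic F G.
  rewrite -LQ -!comp_functorA => /natiso_quotient.
  exact: (natiso_localization locL).
have invQ : inverts I Q.
  move=> X Y f If; rewrite -LQ; apply: (locL.1); exact: bar_class_image.
have kill_j := additive_kills (j_upper_add R)
  (fun X => (preim_iso_nullP (j_upper_add R) X).1).
pose jbar : functor (bar_cat I) C := descend (lc_null I) kill_j.
have jbarE : comp_functor jbar (bar_functor I) = j_upper R.
  exact: descend_quotient.
have inv_jbar : inverts (@bar_class B I) jbar.
  by apply: bar_class_inverted; rewrite jbarE => X Y f.
have [jt [jtL _]] := locL.2 C jbar inv_jbar.
have jtQ : comp_functor jt Q = j_upper R by rewrite -LQ -comp_functorA jtL.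
exists jt; split; last first.
  by move=> jt' [_ jt'Q]; apply: cancelQ; rewrite jtQ.
split=> //; exists (comp_functor Q (j_lower R)); split.
  apply/natiso_sym/natiso_cancelQ.
  rewrite comp_id_functor comp_functorA jtQ.
  exact: (natiso_reflection (adj_ju_jl R) (j_lower_ff R) invQ).
rewrite -comp_functorA jtQ.
exact: (natiso_counit (adj_ju_jl R) (j_lower_ff R)).
Qed.
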